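(* Let $S \subseteq \mathbb{Z}$ with $|S| = 4$. Then $p_{\mathbb{Z}}(S) \ge 3$; that is, there is a coloring of $\mathbb{Z}$ with $3$ colors such that every translate $n+S$, $n \in \mathbb{Z}$, contains an element of each of the three colors.
   Context: For an abelian group $G$, $S \subseteq G$ and $n \in G$, the set $n+S=\{n+s : s\in S\}$ is a translate of $S$. A coloring of the elements of $G$ is $S$-polychromatic if every translate of $S$ contains an element of each color. The polychromatic number $p_G(S)$ (written $p(S)$ when $G$ is clear) is the largest number of colors for which an $S$-polychromatic coloring of $G$ exists. *)

(* Defs.v *)
From mathcomp Require Import all_boot all_order all_algebra.
Set Implicit Arguments. Unset Strict Implicit. Unset Printing Implicit Defensive.
Import GRing.Theory.
Local Open Scope ring_scope.

(* A finite subset S of an abelian group G is represented by a duplicate-free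
   sequence S : seq G.  A coloring of G with k colors is a function G -> 'I_k.
   It is S-polychromatic if every translate n + S contains each color. *)
Definition translate (G : zmodType) (n : G) (S : seq G) : seq G :=
  [seq n + s | s <- S].

Definition polychromatic (G : zmodType) (k : nat) (S : seq G) (c : G -> 'I_k) : Prop :=
  forall (n : G) (i : 'I_k), exists2 x, x \in translate n S & c x = i.

(* Main.v *)
Require Import Defs.
From Stdlib Require Import ZArith Znumtheory Lia Bool.
From mathcomp Require Import all_boot all_order all_algebra.
From mathcomp Require Import zify ssrZ.
Set Implicit Arguments.
Unset Strict Implicit.

(** Translate and rescale so that S = {0, a, b, c} with 0 < a < b < c coprime, and
    put m = b + c - a, so that S = {0, b, c, b + c} modulo m.  If for some k the
    four points k S of the circle Z/mZ have all gaps at most m/3, coloring n by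
    the third of the circle containing k n is polychromatic.  In terms of
    (s, t) = (k b, k c) the gap condition defines a fixed region D of the torus
    (a diamond around (m/2, m/2) minus a square), and the point is to find a
    multiple of (b, c) in D.

    - If m > 225, the pigeonhole principle gives a multiple (X, Y) of (b, c) with
      |X|, |Y| <= m/15, and up to symmetry 0 <= Y <= X.  Every line through the
      origin with slope in (0, 1) meets D in a chord longer than such a step.
      If the slope is 0 or 1, translate the line by another multiple of (b, c);
      this fails only if 2 (b - c) or 2 (b + c) is 0 modulo m.
    - If 40 < m <= 225, an enumeration of the subgroups generated by (b, c), in
      Hermite normal form, finds the multiple.
    - If m <= 40, other moduli than m serve, except for {0, 1, 7, 9} and its
      mirror image, which get an explicit word of period 15.

    The exceptional case 2 (b - c) = 0 or 2 (b + c) = 0 modulo m means that S is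
    a translate of some {0, p, q, - p - q}.  Here p and q can be taken odd with
    |p| >= 3; modulo 2p the set is then a multiple of {0, 1, p - 1, p}, which is
    colored by an explicit word. *)

Lemma pigeonhole_nat (N : nat) (F : nat -> nat) :
  (forall i, (i <= N)%N -> (F i < N)%N) ->
  exists i j, [/\ (i < j)%N, (j <= N)%N & F i = F j].
Proof.
case: N => [|N] FN; first by have := FN 0%N isT.
pose f (i : 'I_N.+2) : 'I_N.+1 := inord (F i).
have: ~~ injectiveb f.
  by apply/injectiveP => /leq_card; rewrite !card_ord ltnn.
case/injectivePn => i [j neq_ij /(congr1 val) /=].
rewrite !inordK; try by apply: FN; rewrite -ltnS ltn_ord.
wlog: i j neq_ij / (i < j)%N => [IH eqF | lt_ij eqF]; last first.
  by exists i, j; split=> //; rewrite -ltnS ltn_ord.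
case: (ltngtP i j) => [lt_ij | lt_ji | /val_inj eq_ij].
- exact: IH lt_ij eqF.
- by apply: (IH j i); rewrite // eq_sym.
- by rewrite eq_ij eqxx in neq_ij.
Qed.

Section IntegerSets.
Local Open Scope Z_scope.

(** * Circle colorings *)

(** Only 0, 1 and 2 count as colors; any other value of [f] is sent to color 0 when the coloring is
    transferred to ['I_3]. *)
Definition good (a b c d : Z) : Prop :=
  exists f : Z -> Z, forall n i, 0 <= i < 3 ->
    f (n + a) = i \/ f (n + b) = i \/ f (n + c) = i \/ f (n + d) = i.

Lemma good_swap12 a b c d : good a b c d -> good b a c d.
Proof. intros [f H]; exists f; intros n i Hi; destruct (H n i Hi) as [?|[?|[?|?]]]; tauto. Qed.

Lemma good_swap23 a b c d : good a b c d -> good a c b d.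
Proof. intros [f H]; exists f; intros n i Hi; destruct (H n i Hi) as [?|[?|[?|?]]]; tauto. Qed.

Lemma good_swap34 a b c d : good a b c d -> good a b d c.
Proof. intros [f H]; exists f; intros n i Hi; destruct (H n i Hi) as [?|[?|[?|?]]]; tauto. Qed.

Lemma good_translate t a b c d :
  good a b c d -> good (a + t) (b + t) (c + t) (d + t).
Proof.
intros [f H]; exists f; intros n i Hi.
rewrite !Z.add_assoc -!(Z.add_shuffle0 n t); exact (H (n + t) i Hi).
Qed.

Lemma good_opp a b c d : good a b c d -> good (- a) (- b) (- c) (- d).
Proof.
intros [f H]; exists (fun x => f (- x)); intros n i Hi.
rewrite !Z.opp_add_distr !Z.opp_involutive; exact (H (- n) i Hi).
Qed.

Lemma good_scale g a b c d :
  0 < g -> good a b c d -> good (g * a) (g * b) (g * c) (g * d).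
Proof.
intros Hg [f H]; exists (fun x => f (x / g)); intros n i Hi.
assert (E : forall x, (n + g * x) / g = n / g + x).
{ intro x; rewrite Z.mul_comm Z.div_add; lia. }
rewrite !E; exact (H (n / g) i Hi).
Qed.

(* The colour of [x] is the third of the circle Z/mZ that contains [k x]: an arc
   of length m/3 cannot avoid points whose gaps are at most m/3. *)
Lemma good_circle m k a b c d qa qb qc qd :
  0 < m ->
  k * a - m * qa <= k * b - m * qb <= k * c - m * qc ->
  k * c - m * qc <= k * d - m * qd <= k * a - m * qa + m ->
  3 * ((k * b - m * qb) - (k * a - m * qa)) <= m ->
  3 * ((k * c - m * qc) - (k * b - m * qb)) <= m ->
  3 * ((k * d - m * qd) - (k * c - m * qc)) <= m ->
  3 * ((k * a - m * qa + m) - (k * d - m * qd)) <= m ->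
  good a b c d.
Proof.
intros Hm H1 H2 G1 G2 G3 G4.
exists (fun x => 3 * ((k * x) mod m) / m); intros n i Hi.
assert (E : forall x l, i * m <= 3 * (k * (n + x) - m * l) < (i + 1) * m ->
            3 * ((k * (n + x)) mod m) / m = i).
{ intros x l Hl.
  assert (Er : (k * (n + x)) mod m = k * (n + x) - m * l).
  { symmetry; apply (Z.mod_unique_pos _ _ l); nia. }
  rewrite Er; symmetry; apply (Z.div_unique_pos _ _ _ (3 * (k * (n + x) - m * l) - m * i)); nia. }
(* [l] counts the turns after which [k (n + a)] last precedes the end of arc [i]. *)
pose proof (Z.div_mod (3 * (k * n + k * a - m * qa) - (i + 1) * m) (3 * m) ltac:(lia)) as Hd.
pose proof (Z.mod_pos_bound (3 * (k * n + k * a - m * qa) - (i + 1) * m) (3 * m) ltac:(lia)) as Hr.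
set (l := (3 * (k * n + k * a - m * qa) - (i + 1) * m) / (3 * m)) in *.
set (r := (3 * (k * n + k * a - m * qa) - (i + 1) * m) mod (3 * m)) in *.
clearbody l r.
(* The last point before the end of arc i lies in the arc: the next point is past the end and at
   most m/3 away. *)
destruct (Z_lt_le_dec (3 * (k * n + (k * d - m * qd) - m * (l + 1))) ((i + 1) * m)).
{ right; right; right; apply (E d (qd + (l + 1))); nia. }
destruct (Z_lt_le_dec (3 * (k * n + (k * c - m * qc) - m * (l + 1))) ((i + 1) * m)).
{ right; right; left; apply (E c (qc + (l + 1))); nia. }
destruct (Z_lt_le_dec (3 * (k * n + (k * b - m * qb) - m * (l + 1))) ((i + 1) * m)).
{ right; left; apply (E b (qb + (l + 1))); nia. }
left; apply (E a (qa + (l + 1))); nia.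
Qed.

(* [inD m s t] says that the points 0, s, t, s + t of the circle Z/mZ have all
   their gaps at most m/3. *)
Definition inD (m s t : Z) : bool :=
  (3 * Z.abs (2 * s - m) + 3 * Z.abs (2 * t - m) <=? 2 * m) &&
  ((m <=? 3 * Z.abs (2 * s - m)) || (m <=? 3 * Z.abs (2 * t - m))).

Lemma inDP m s t : inD m s t = true <->
  3 * Z.abs (2 * s - m) + 3 * Z.abs (2 * t - m) <= 2 * m /\
  (m <= 3 * Z.abs (2 * s - m) \/ m <= 3 * Z.abs (2 * t - m)).
Proof. unfold inD; rewrite Bool.andb_true_iff Bool.orb_true_iff !Z.leb_le; tauto. Qed.

Definition hit (m x y : Z) : Prop :=
  exists k p q, inD m (k * x - m * p) (k * y - m * q) = true.

Lemma good_hit m x y : 0 < m -> hit m x y -> good 0 x y (x + y - m).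
Proof.
intros Hm [k [p [q H]]]; apply inDP in H.
remember (k * x - m * p) as s eqn:Es; remember (k * y - m * q) as t eqn:Et.
(* For s <= t the cyclic order is 0, s, t, s + t if s + t <= m, and 0, s + t - m, s, t otherwise. *)
destruct (Z_le_gt_dec s t); destruct (Z_le_gt_dec (s + t) m).
- apply (@good_circle m k 0 x y (x + y - m) 0 p q (p + q - k)); lia.
- apply good_swap34, good_swap23.
  apply (@good_circle m k 0 (x + y - m) x y 0 (p + q + 1 - k) p q); lia.
- apply good_swap23.
  apply (@good_circle m k 0 y x (x + y - m) 0 q p (p + q - k)); lia.
- apply good_swap23, good_swap34, good_swap23.
  apply (@good_circle m k 0 (x + y - m) y x 0 (p + q + 1 - k) q p); lia.
Qed.

(** * Large modulus *)

Lemma hit_swap m x y : hit m x y -> hit m y x.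
Proof.
intros [k [p [q H]]]; exists k, q, p; apply inDP; apply inDP in H; lia.
Qed.

(** D is symmetric about s = m/2; the extra turn replaces s by m - s. *)
Lemma hit_oppl m x y : hit m x y -> hit m (- x) y.
Proof.
intros [k [p [q H]]]; exists k, (- p - 1), q; apply inDP; apply inDP in H; lia.
Qed.

Lemma hit_multiple m x y k X Y p q :
  k * x = X + m * p -> k * y = Y + m * q -> hit m X Y -> hit m x y.
Proof.
intros Hx Hy [j [p' [q' H]]]; exists (j * k), (j * p + p'), (j * q + q').
replace (j * k * x - m * (j * p + p')) with (j * X - m * p') by nia.
replace (j * k * y - m * (j * q + q')) with (j * Y - m * q') by nia.
exact H.
Qed.

Lemma multiple_in_window X T : 0 < X -> exists k, T <= k * X < T + X.
Proof.
intro HX; exists (- ((- T) / X)).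
pose proof (Z.div_mod (- T) X ltac:(lia)); pose proof (Z.mod_pos_bound (- T) X HX); nia.
Qed.

(* Steps of slope at most 1/9: t is first brought to [m/5], and it is still at most
   [m/3] when s has completed a further turn. *)
Lemma hit_flat m X Y : 0 < Y -> 9 * Y <= X -> 15 * X <= m -> hit m X Y.
Proof.
intros HY H9 HX.
destruct (@multiple_in_window (5 * Y) m) as [k1 H1]; [lia|].
destruct (@multiple_in_window m (k1 * X - (7 * m) / 15)) as [p Hp]; [lia|].
pose proof (Z.div_mod (7 * m) 15 ltac:(lia)); pose proof (Z.mod_pos_bound (7 * m) 15 ltac:(lia)).
(* D contains every point with s in [7m/15, 8m/15] and t in [m/5, m/3]. *)
destruct (@multiple_in_window (15 * X) (7 * m + 15 * (p * m))) as [k Hk]; [lia|].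
assert (Hkk : k1 <= k) by nia.
assert (9 * ((k - k1) * Y) <= (k - k1) * X) by nia.
assert (0 <= (k - k1) * Y) by nia.
exists k, p, 0; apply inDP; lia.
Qed.

(* Steps of slope at least 6/7: now s - t moves slowly and plays the role of t. *)
Lemma hit_diagonal m X Y : Y < X -> 6 * X <= 7 * Y -> 15 * X <= m -> hit m X Y.
Proof.
intros HY H7 HX.
destruct (@multiple_in_window (15 * (X - Y)) (2 * m)) as [k1 H1]; [lia|].
destruct (@multiple_in_window m (k1 * Y - (4 * m) / 15)) as [p Hp]; [lia|].
pose proof (Z.div_mod (4 * m) 15 ltac:(lia)); pose proof (Z.mod_pos_bound (4 * m) 15 ltac:(lia)).
(* D contains every point with t in [4m/15, m/3] and s - t in [2m/15, m/3]. *)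
destruct (@multiple_in_window (15 * Y) (4 * m + 15 * (p * m))) as [k Hk]; [lia|].
assert (Hkk : k1 <= k) by nia.
assert (6 * ((k - k1) * (X - Y)) <= (k - k1) * Y) by nia.
assert (0 <= (k - k1) * (X - Y)) by nia.
exists k, p, p; apply inDP; lia.
Qed.

(* A window [A m/60, (A + 4) m/60] for s is as long as the largest step allowed, so
   it suffices that it works for all slopes between n1/d1 and n2/d2. *)
Lemma hit_window A p q n1 d1 n2 d2 m X Y :
  0 <= A -> 0 < X -> 15 * X <= m -> n1 * X <= d1 * Y -> d2 * Y <= n2 * X ->
  (forall u v, A * m <= 60 * u <= (A + 4) * m -> n1 * u <= d1 * v -> d2 * v <= n2 * u ->
     inD m (u - m * p) (v - m * q) = true) ->
  hit m X Y.
Proof.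
intros HA HX HXm H1 H2 H.
destruct (@multiple_in_window (60 * X) (A * m)) as [k Hk]; [lia|].
assert (0 <= k) by nia.
exists k, p, q; apply H; nia.
Qed.

Lemma hit_line m X Y : 0 < Y < X -> 15 * X <= m -> hit m X Y.
Proof.
intros HY HX.
destruct (Z_le_gt_dec (9 * Y) X); [apply hit_flat; lia|].
destruct (Z_le_gt_dec (6 * X) (7 * Y)); [apply hit_diagonal; lia|].
(* Eight intervals cover the slopes from 1/9 to 6/7; [p] and [q] count the full turns of s and t
   before D is met. *)
destruct (Z_le_gt_dec (13 * Y) (2 * X)).
{ apply (@hit_window 220 3 0 1 9 2 13); try lia; intros; apply inDP; lia. }
destruct (Z_le_gt_dec (14 * Y) (3 * X)).
{ apply (@hit_window 87 1 0 2 13 3 14); try lia; intros; apply inDP; lia. }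
destruct (Z_le_gt_dec (19 * Y) (5 * X)).
{ apply (@hit_window 136 2 0 3 14 5 19); try lia; intros; apply inDP; lia. }
destruct (Z_le_gt_dec (3 * Y) X).
{ apply (@hit_window 100 1 0 5 19 1 3); try lia; intros; apply inDP; lia. }
destruct (Z_le_gt_dec (11 * Y) (5 * X)).
{ apply (@hit_window 76 1 0 1 3 5 11); try lia; intros; apply inDP; lia. }
destruct (Z_le_gt_dec (5 * Y) (3 * X)).
{ apply (@hit_window 28 0 0 5 11 3 5); try lia; intros; apply inDP; lia. }
destruct (Z_le_gt_dec (5 * Y) (4 * X)).
{ apply (@hit_window 40 0 0 3 5 4 5); try lia; intros; apply inDP; lia. }
apply (@hit_window 89 1 1 4 5 6 7); try lia; intros; apply inDP; lia.
Qed.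

Lemma centered_residue m y : 0 < m -> exists e r, (e = 1 \/ e = -1) /\ 0 <= 2 * (e * y - m * r) <= m.
Proof.
intro Hm.
pose proof (Z.div_mod y m ltac:(lia)); pose proof (Z.mod_pos_bound y m Hm).
destruct (Z_le_gt_dec (2 * (y mod m)) m).
- exists 1, (y / m); lia.
- exists (-1), (- (y / m) - 1); lia.
Qed.

(** The arc [2m/15, m/3] has length m/5, so steps of at most m/5 cannot jump over it. *)
Lemma multiple_in_arc m w : 0 < w -> 5 * w <= m ->
  exists k, 2 * m <= 15 * (k * w) /\ 3 * (k * w) <= m.
Proof.
intros Hw H; destruct (@multiple_in_window (15 * w) (2 * m)) as [k Hk]; [lia|].
exists k; lia.
Qed.

(** Steps by (X, 0) sweep the row of any multiple of (x, y). Rows at height in [m/5, m/3] or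
    [2m/5, 3m/5] meet D in a chord of length at least m/15, and some multiple of y, nonzero modulo
    m, reaches such a height. *)
Lemma hit_horizontal m x y k X p q : 0 < X -> 15 * X <= m ->
  k * x = X + m * p -> k * y = m * q -> ~ (m | y) -> hit m x y.
Proof.
intros HX HXm Hx Hy Hn.
assert (Hmid : exists k1 r, (3 * m <= 15 * (k1 * y - m * r) <= 5 * m) \/
                       (2 * m <= 5 * (k1 * y - m * r) <= 3 * m)).
{ destruct (@centered_residue m y) as [e [r [He Hr]]]; [lia|].
  assert (Hne : e * y - m * r <> 0).
  { intro E; apply Hn; exists (e * r); destruct He; subst e; lia. }
  set (t := e * y - m * r) in *.
  assert (Ht : forall j, j * t = j * e * y - m * (j * r)) by (intro j; unfold t; ring).
  clearbody t.
  destruct (Z_le_gt_dec (15 * t) (2 * m)).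
  { destruct (@multiple_in_window (5 * t) m) as [j Hj]; [lia|].
    exists (j * e), (j * r); rewrite -Ht; left; lia. }
  destruct (Z_le_gt_dec (6 * t) m).
  { exists (2 * e), (2 * r); rewrite -Ht; left; lia. }
  destruct (Z_lt_le_dec (5 * t) m).
  { exists (3 * e), (3 * r); rewrite -Ht; right; lia. }
  destruct (Z_le_gt_dec (3 * t) m).
  { exists (1 * e), (1 * r); rewrite -Ht; left; lia. }
  destruct (Z_lt_le_dec (5 * t) (2 * m)).
  { exists (-2 * e), (-2 * r - 1).
    replace (-2 * e * y - m * (-2 * r - 1)) with (m + (-2) * t) by (rewrite (Ht (-2)); ring).
    left; lia. }
  exists (1 * e), (1 * r); rewrite -Ht; right; lia. }
destruct Hmid as [k1 [r [Hr|Hr]]].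
- destruct (@multiple_in_window (15 * X) (7 * m - 15 * (k1 * x))) as [j Hj]; [lia|].
  pose proof (f_equal (Z.mul j) Hx); pose proof (f_equal (Z.mul j) Hy).
  exists (k1 + j * k), (j * p), (r + j * q).
  replace ((k1 + j * k) * x - m * (j * p)) with (k1 * x + j * X) by lia.
  replace ((k1 + j * k) * y - m * (r + j * q)) with (k1 * y - m * r) by lia.
  apply inDP; lia.
- destruct (@multiple_in_window (15 * X) (4 * m - 15 * (k1 * x))) as [j Hj]; [lia|].
  pose proof (f_equal (Z.mul j) Hx); pose proof (f_equal (Z.mul j) Hy).
  exists (k1 + j * k), (j * p), (r + j * q).
  replace ((k1 + j * k) * x - m * (j * p)) with (k1 * x + j * X) by lia.
  replace ((k1 + j * k) * y - m * (r + j * q)) with (k1 * y - m * r) by lia.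
  apply inDP; lia.
Qed.

(** Steps by (X, X) preserve s - t, so it suffices to bring a multiple of x - y into [2m/15, m/3].
    This is possible unless x - y is 0 or m/2 modulo m; near m/2, doubling gives a small residue. *)
Lemma hit_same_steps m x y k X p q : 0 < X -> 15 * X <= m ->
  k * x = X + m * p -> k * y = X + m * q -> ~ (m | 2 * (x - y)) -> hit m x y.
Proof.
intros HX HXm Hx Hy Hn.
assert (Hmid : exists k1 r, 2 * m <= 15 * (k1 * (x - y) - m * r) /\
                       3 * (k1 * (x - y) - m * r) <= m).
{ destruct (@centered_residue m (x - y)) as [e [r [He Hr]]]; [lia|].
  assert (Hne : 2 * (e * (x - y) - m * r) <> 0 /\ 2 * (e * (x - y) - m * r) <> m).
  { split; intro E; apply Hn.
    - exists (2 * e * r); destruct He; subst e; lia.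
    - exists (2 * e * r + e); destruct He; subst e; lia. }
  set (t := e * (x - y) - m * r) in *.
  assert (Ht : forall j, j * t = j * e * (x - y) - m * (j * r)) by (intro j; unfold t; ring).
  clearbody t.
  destruct (Z_le_gt_dec (5 * t) m).
  { destruct (@multiple_in_arc m t) as [j Hj]; [lia|lia|].
    exists (j * e), (j * r); rewrite -Ht; exact Hj. }
  destruct (Z_le_gt_dec (3 * t) m).
  { exists (1 * e), (1 * r); rewrite -Ht; lia. }
  destruct (Z_le_gt_dec (5 * (m - 2 * t)) m).
  { destruct (@multiple_in_arc m (m - 2 * t)) as [j Hj]; [lia|lia|].
    exists (-2 * j * e), (-2 * j * r - j).
    replace (-2 * j * e * (x - y) - m * (-2 * j * r - j)) with (j * (m - 2 * t)).
    - exact Hj.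
    - transitivity (j * m + (-2 * j) * t); [ring|rewrite Ht; ring]. }
  exists (-2 * e), (-2 * r - 1).
  replace (-2 * e * (x - y) - m * (-2 * r - 1)) with (m + (-2) * t) by (rewrite (Ht (-2)); ring).
  lia. }
destruct Hmid as [k1 [r Hr]].
destruct (@multiple_in_window (15 * X) (4 * m - 15 * (k1 * y))) as [j Hj]; [lia|].
pose proof (f_equal (Z.mul j) Hx); pose proof (f_equal (Z.mul j) Hy).
exists (k1 + j * k), (r + j * p), (j * q).
replace ((k1 + j * k) * x - m * (r + j * p)) with ((k1 * y + j * X) + (k1 * (x - y) - m * r)) by lia.
replace ((k1 + j * k) * y - m * (j * q)) with (k1 * y + j * X) by lia.
apply inDP; lia.
Qed.

(** Among the multiples numbered 0 to 225, two share one of the 15 * 15 cells of side m/15; [k] is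
    the difference of their numbers. *)
Lemma close_multiples m x y : 225 < m ->
  exists k p q, 1 <= k <= 225 /\
    Z.abs (15 * (k * x - m * p)) <= m /\ Z.abs (15 * (k * y - m * q)) <= m.
Proof.
intro Hm.
pose (u (z : Z) (i : nat) := (15 * ((Z.of_nat i * z) mod m)) / m).
assert (Hu : forall z i, 0 <= u z i < 15).
{ intros z i; unfold u; pose proof (Z.mod_pos_bound (Z.of_nat i * z) m ltac:(lia)).
  split; [apply Z.div_pos; lia|apply Z.div_lt_upper_bound; lia]. }
destruct (@pigeonhole_nat 225 (fun i => Z.to_nat (15 * u x i + u y i))) as [i [j [Hij Hj E]]].
{ intros i _; apply/ltP; pose proof (Hu x i); pose proof (Hu y i); lia. }
move/ltP: Hij => Hij; move/leP: Hj => Hj.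
pose proof (Hu x i); pose proof (Hu y i); pose proof (Hu x j); pose proof (Hu y j).
assert (Ex : u x i = u x j) by lia; assert (Ey : u y i = u y j) by lia.
assert (D : forall z, u z i = u z j ->
   Z.abs (15 * ((Z.of_nat j - Z.of_nat i) * z - m * ((Z.of_nat j * z) / m - (Z.of_nat i * z) / m))) <= m).
{ intros z Ez; unfold u in Ez.
  pose proof (Z.div_mod (Z.of_nat i * z) m ltac:(lia)).
  pose proof (Z.div_mod (Z.of_nat j * z) m ltac:(lia)).
  pose proof (Z.div_mod (15 * ((Z.of_nat i * z) mod m)) m ltac:(lia)) as Di.
  pose proof (Z.div_mod (15 * ((Z.of_nat j * z) mod m)) m ltac:(lia)) as Dj.
  pose proof (Z.mod_pos_bound (15 * ((Z.of_nat i * z) mod m)) m ltac:(lia)).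
  pose proof (Z.mod_pos_bound (15 * ((Z.of_nat j * z) mod m)) m ltac:(lia)).
  rewrite Ez in Di; lia. }
exists (Z.of_nat j - Z.of_nat i), ((Z.of_nat j * x) / m - (Z.of_nat i * x) / m),
  ((Z.of_nat j * y) / m - (Z.of_nat i * y) / m).
split; [lia|split; apply D; assumption].
Qed.

Lemma hit_step m x y k X Y p q : 0 <= Y <= X -> 0 < X -> 15 * X <= m ->
  k * x = X + m * p -> k * y = Y + m * q ->
  ~ (m | y) -> ~ (m | 2 * (x - y)) -> hit m x y.
Proof.
intros HY HX HXm Hx Hy Ny Nd.
destruct (Z.eq_dec Y 0) as [E|E].
{ apply (@hit_horizontal m x y k X p q); auto; lia. }
destruct (Z.eq_dec Y X) as [E'|E'].
{ apply (@hit_same_steps m x y k X p q); auto; lia. }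
apply (@hit_multiple m x y k X Y p q); auto; apply hit_line; lia.
Qed.

Lemma divide_gcd3 m x y k : Z.gcd x (Z.gcd y m) = 1 -> (m | k * x) -> (m | k * y) -> (m | k).
Proof.
intros G Hx Hy.
destruct (Z.gcd_bezout _ _ _ G) as [a [b E]].
destruct (Z.gcd_bezout y m _ erefl) as [c [d E']].
replace k with (a * (k * x) + b * c * (k * y) + b * d * k * m).
- apply Z.divide_add_r; [apply Z.divide_add_r|].
  + apply Z.divide_mul_r; exact Hx.
  + apply Z.divide_mul_r; exact Hy.
  + apply Z.divide_factor_r.
- rewrite -E' in E; transitivity (k * (a * x + b * (c * y + d * m))); [ring|rewrite E; ring].
Qed.

Lemma hit_large m x y : 225 < m -> Z.gcd x (Z.gcd y m) = 1 ->
  ~ (m | x) -> ~ (m | y) -> ~ (m | 2 * (x - y)) -> ~ (m | 2 * (x + y)) -> hit m x y.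
Proof.
intros Hm G Nx Ny Nd Ns.
destruct (@close_multiples m x y Hm) as [k [p [q [Hk [HX HY]]]]].
(* By coprimality and 0 < k < m, the short multiple is not (0, 0). *)
assert (NZ : k * x - m * p <> 0 \/ k * y - m * q <> 0).
{ destruct (Z.eq_dec (k * x - m * p) 0); [right; intro|left; assumption].
  assert (D : (m | k)).
  { apply (@divide_gcd3 m x y); [assumption|exists p; lia|exists q; lia]. }
  apply Z.divide_pos_le in D; lia. }
assert (nonneg : forall x y p q, ~ (m | x) -> ~ (m | y) ->
  ~ (m | 2 * (x - y)) -> ~ (m | 2 * (x + y)) ->
  0 <= 15 * (k * x - m * p) <= m -> 0 <= 15 * (k * y - m * q) <= m ->
  k * x - m * p <> 0 \/ k * y - m * q <> 0 -> hit m x y).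
{ clear; intros x y p q Nx Ny Nd Ns HX HY NZ.
  destruct (Z_le_gt_dec (k * y - m * q) (k * x - m * p)).
  - apply (@hit_step m x y k (k * x - m * p) (k * y - m * q) p q); auto; lia.
  - apply hit_swap, (@hit_step m y x k (k * y - m * q) (k * x - m * p) q p); auto; try lia.
    intro D; apply Nd; apply Z.divide_opp_r in D.
    replace (2 * (x - y)) with (- (2 * (y - x))) by ring; exact D. }
assert (No : forall z, ~ (m | z) -> ~ (m | - z)).
{ intros z Nz D; apply Nz, Z.divide_opp_r; exact D. }
destruct (Z_le_gt_dec 0 (k * x - m * p)); destruct (Z_le_gt_dec 0 (k * y - m * q)).
- apply (@nonneg x y p q); auto; lia.
- apply hit_swap; rewrite -(Z.opp_involutive y); apply hit_oppl, hit_swap.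
  apply (@nonneg x (- y) p (- q)); auto; try lia.
  replace (x - - y) with (x + y) by ring; exact Ns.
- rewrite -(Z.opp_involutive x); apply hit_oppl.
  apply (@nonneg (- x) y (- p) q); auto; try lia.
  + replace (2 * (- x - y)) with (- (2 * (x + y))) by ring; auto.
  + replace (2 * (- x + y)) with (- (2 * (x - y))) by ring; auto.
- rewrite -(Z.opp_involutive x); apply hit_oppl, hit_swap.
  rewrite -(Z.opp_involutive y); apply hit_oppl, hit_swap.
  apply (@nonneg (- x) (- y) (- p) (- q)); auto; try lia.
  + replace (2 * (- x - - y)) with (- (2 * (x - y))) by ring; auto.
  + replace (2 * (- x + - y)) with (- (2 * (x + y))) by ring; auto.
Qed.

(** * Medium modulus *)

(** The conditional, unlike a boolean connective, lets call-by-value evaluation stop early. *)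
Fixpoint anyb (k : nat) (P : Z -> bool) (i : Z) : bool :=
  if k is S k' then if P i then true else anyb k' P (i + 1) else false.

Fixpoint allb (k : nat) (P : Z -> bool) (i : Z) : bool :=
  if k is S k' then if P i then allb k' P (i + 1) else false else true.

Lemma anybP k P i : anyb k P i = true -> exists j, i <= j < i + Z.of_nat k /\ P j = true.
Proof.
revert i; induction k as [|k IH]; intro i; cbn [anyb]; [discriminate|].
destruct (P i) eqn:E.
- intros _; exists i; split; [lia|exact E].
- intro H; destruct (IH _ H) as [j [Hj Pj]]; exists j; split; [lia|exact Pj].
Qed.

Lemma allbP k P i : allb k P i = true -> forall j, i <= j < i + Z.of_nat k -> P j = true.
Proof.
revert i; induction k as [|k IH]; intros i H j Hj; [lia|].
cbn [allb] in H; destruct (P i) eqn:E; [|discriminate].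
destruct (Z.eq_dec i j) as [<-|N]; [exact E|apply (IH _ H); lia].
Qed.

(* The multiples of (x, y) in (Z/m)^2 form the subgroup generated by (g, z) and
   (0, n), where g = gcd x m and m = g n; there are far fewer triples (g, n, z)
   than triples (m, x, y).  For each i the second coordinate tried is the
   largest one below m/3 + s. *)
Definition hnf_hit (g n z : Z) : bool :=
  anyb (Z.to_nat n) (fun i =>
    inD (g * n) (g * i)
      ((z * i) mod n + n * ((g * n / 3 + g * i - (z * i) mod n) / n))) ((n + 5) / 6).

(** These cases force x, y or 2 (x - y), 2 (x + y) to vanish modulo m. For the last two, (x, y) is a
    multiple of (g, z) plus one of (0, n), and 2 (0, n) vanishes modulo g n because g divides 2. *)
Definition hnf_degenerate (g n z : Z) : bool :=
  (n =? 1) || ((g =? 1) && (z =? 0)) ||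
  ((g <=? 2) && (((2 * (g - z)) mod (g * n) =? 0) || ((2 * (g + z)) mod (g * n) =? 0))).

Definition hnf_check (lo hi : Z) : bool :=
  allb (Z.to_nat hi) (fun n => allb (Z.to_nat (hi / n)) (fun g =>
    if g * n <=? lo then true else
    allb (Z.to_nat n) (fun z => if hnf_hit g n z then true else hnf_degenerate g n z) 0) 1) 1.

Lemma hnf_checkP lo hi g n z : hnf_check lo hi = true ->
  0 < g -> 0 < n -> lo < g * n <= hi -> 0 <= z < n ->
  hnf_hit g n z = true \/ hnf_degenerate g n z = true.
Proof.
intros H Hg Hn Hm Hz.
assert (Hgn : g <= hi / n) by (apply Z.div_le_lower_bound; lia).
assert (Hnhi : n <= hi) by nia.
pose proof (allbP H (j := n) ltac:(lia)) as H1; cbv beta in H1.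
pose proof (allbP H1 (j := g) ltac:(lia)) as H2; cbv beta in H2.
destruct (Z.leb_spec (g * n) lo); [lia|].
pose proof (allbP H2 (j := z) ltac:(lia)) as H3; cbv beta in H3.
destruct (hnf_hit g n z); [left; reflexivity|right; exact H3].
Qed.

Lemma hnf_check_40_225 : hnf_check 40 225 = true.
Proof. vm_cast_no_check (erefl true). Qed.

Lemma hit_medium m x y : 40 < m <= 225 -> Z.gcd x (Z.gcd y m) = 1 ->
  ~ (m | x) -> ~ (m | y) -> ~ (m | 2 * (x - y)) -> ~ (m | 2 * (x + y)) -> hit m x y.
Proof.
intros Hm G Nx Ny Nd Ns.
destruct (Z.gcd_bezout x m _ erefl) as [u [v Hu]].
destruct (Z.gcd_divide_l x m) as [i0 Hx].
destruct (Z.gcd_divide_r x m) as [n Hn].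
pose proof (Z.gcd_nonneg x m).
assert (Gy : Z.gcd y (Z.gcd x m) = 1).
{ rewrite Z.gcd_assoc (Z.gcd_comm y x) -Z.gcd_assoc; exact G. }
set (g := Z.gcd x m) in *; clearbody g.
assert (Hg : 0 < g) by (destruct (Z.eq_dec g 0) as [E|]; [rewrite E in Hn; lia|lia]).
assert (Hn0 : 0 < n) by nia.
destruct (Z.gcd_bezout _ _ _ Gy) as [l [h Hl]].
pose proof (Z.div_mod (u * y) n ltac:(lia)) as Hz.
pose proof (Z.mod_pos_bound (u * y) n ltac:(lia)) as Hzb.
set (c := (u * y) / n) in *; set (z := (u * y) mod n) in *; clearbody c z.
assert (Hui : u * i0 + v * n = 1) by nia.
assert (Hy : y = z * i0 + n * (c * i0 + v * y)).
{ transitivity ((u * i0 + v * n) * y); [rewrite Hui; ring|].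
  transitivity (i0 * (u * y) + v * n * y); [ring|rewrite Hz; ring]. }
destruct (@hnf_checkP 40 225 g n z hnf_check_40_225) as [H1|H1]; try lia.
- apply anybP in H1; destruct H1 as [i [_ Hi]]; cbv beta in Hi.
  pose proof (Z.div_mod (z * i) n ltac:(lia)) as Hzi.
  set (w := (g * n / 3 + g * i - (z * i) mod n) / n) in *; clearbody w.
  set (J := w - (z * i) / n).
  replace ((z * i) mod n + n * w) with (z * i + n * J) in Hi by (unfold J; lia).
  clearbody J.
  (* Modulo m, u (x, y) = (g, z + n c) and n l (x, y) = (0, n); this gives the multiplier that
     yields i (g, z) + J (0, n). *)
  exists (u * i + n * (l * (J - i * c))), (- i * v + i0 * (l * (J - i * c))), (- h * (J - i * c)).
  replace ((u * i + n * (l * (J - i * c))) * x - m * (- i * v + i0 * (l * (J - i * c))))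
    with (g * i).
  2:{ transitivity (i * (u * x + v * m) + l * (J - i * c) * (n * x - m * i0)).
      - rewrite Hu Hx Hn; ring.
      - ring. }
  replace ((u * i + n * (l * (J - i * c))) * y - m * (- h * (J - i * c))) with (z * i + n * J).
  2:{ transitivity (i * (u * y) + n * (J - i * c) * (l * y + h * g)).
      - rewrite Hl Hz; ring.
      - rewrite Hn; ring. }
  rewrite Hn Z.mul_comm; exact Hi.
- exfalso; unfold hnf_degenerate in H1.
  rewrite !Bool.orb_true_iff !Bool.andb_true_iff !Bool.orb_true_iff in H1.
  rewrite !Z.eqb_eq Z.leb_le in H1.
  rewrite !(Z.mul_comm g n) -Hn in H1.
  destruct H1 as [[E|[E E']]|[E H1]].
  + apply Nx; exists i0; rewrite Hn E Z.mul_1_l; exact Hx.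
  + apply Ny; exists (c * i0 + v * y); rewrite {1}Hy E' Hn E; ring.
  + assert (E2 : exists r, 2 = r * g).
    { assert (g = 1 \/ g = 2) as [->| ->] by lia; [exists 2|exists 1]; reflexivity. }
    destruct E2 as [r Hr].
    destruct H1 as [E1|E1]; apply Z.mod_divide in E1; try lia; destruct E1 as [e He].
    * apply Nd; exists (e * i0 - r * (c * i0 + v * y)).
      set (J := c * i0 + v * y) in *; clearbody J.
      transitivity (i0 * (2 * (g - z)) - r * g * n * J).
      -- rewrite -Hr Hy {1}Hx; ring.
      -- rewrite He Hn; ring.
    * apply Ns; exists (e * i0 + r * (c * i0 + v * y)).
      set (J := c * i0 + v * y) in *; clearbody J.
      transitivity (i0 * (2 * (g + z)) + r * g * n * J).
      -- rewrite -Hr Hy {1}Hx; ring.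
      -- rewrite He Hn; ring.
Qed.

(** * Sets {0, p, q, - p - q} *)

(* The word 0101...012 0202...021 of length 2p, repeated. *)
Definition twisted_word (p i : Z) : Z :=
  let r := i mod (2 * p) in
  if r =? p - 1 then 2 else if r =? 2 * p - 1 then 1
  else if r <? p then r mod 2 else 2 * ((r - p) mod 2).

Lemma twisted_wordE p i q s : 0 < p -> i = 2 * p * q + s -> 0 <= s < 2 * p ->
  twisted_word p i = if s =? p - 1 then 2 else if s =? 2 * p - 1 then 1
    else if s <? p then s mod 2 else 2 * ((s - p) mod 2).
Proof.
intros Hp Ei Hs; unfold twisted_word.
replace (i mod (2 * p)) with s; [reflexivity|].
apply (Z.mod_unique_pos _ _ q); assumption.
Qed.

(** Away from the borders, the neighbours n, n + 1 and n + p - 1, n + p lie in opposite halves, so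
    one pair sees 0, 1 and the other 0, 2. The altered letters at p - 1 and 2p - 1 repair the border
    cases. *)
Lemma twisted_word_good p : 3 <= p -> p mod 2 = 1 -> forall n i, 0 <= i < 3 ->
  twisted_word p n = i \/ twisted_word p (n + p) = i \/
  twisted_word p (n + 1) = i \/ twisted_word p (n + (p - 1)) = i.
Proof.
intros Hp Hodd n i Hi.
pose proof (Z.div_mod n (2 * p) ltac:(lia)) as Hn.
pose proof (Z.mod_pos_bound n (2 * p) ltac:(lia)) as Hr.
set (q := n / (2 * p)) in *; set (s := n mod (2 * p)) in *; clearbody q s.
assert (W : forall d, 0 <= d <= p ->
  (s + d < 2 * p /\ twisted_word p (n + d) =
     if s + d =? p - 1 then 2 else if s + d =? 2 * p - 1 then 1
     else if s + d <? p then (s + d) mod 2 else 2 * ((s + d - p) mod 2)) \/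
  (2 * p <= s + d /\ twisted_word p (n + d) =
     if s + d - 2 * p =? p - 1 then 2 else if s + d - 2 * p =? 2 * p - 1 then 1
     else if s + d - 2 * p <? p then (s + d - 2 * p) mod 2
     else 2 * ((s + d - 2 * p - p) mod 2))).
{ intros d Hd; destruct (Z_lt_le_dec (s + d) (2 * p)); [left|right]; (split; [assumption|]).
  - apply (@twisted_wordE p _ q); lia.
  - apply (@twisted_wordE p _ (q + 1)); lia. }
rewrite -{1}(Z.add_0_r n).
pose proof (W 0 ltac:(lia)) as W0; pose proof (W 1 ltac:(lia)) as W1.
pose proof (W (p - 1) ltac:(lia)) as W2; pose proof (W p ltac:(lia)) as W3; clear W.
set (w0 := twisted_word p (n + 0)) in *; set (w1 := twisted_word p (n + 1)) in *.
set (w2 := twisted_word p (n + (p - 1))) in *; set (w3 := twisted_word p (n + p)) in *.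
clearbody w0 w1 w2 w3; clear Hn.
destruct W0 as [[? E0]|[? E0]]; [|lia].
destruct W1 as [[? E1]|[? E1]]; destruct W2 as [[? E2]|[? E2]]; destruct W3 as [[? E3]|[? E3]];
  try lia;
  repeat match goal with
  | H : context [Z.eqb ?a ?b] |- _ => destruct (Z.eqb_spec a b); try lia
  | H : context [Z.ltb ?a ?b] |- _ => destruct (Z.ltb_spec a b); try lia
  end;
  Z.to_euclidean_division_equations; lia.
Qed.

(* Modulo 2p, multiplication by the inverse of q turns {0, p, q, - p - q} into
   {0, p, 1, p - 1}. *)
Lemma good_zero_sum_odd p q : 3 <= p -> p mod 2 = 1 -> q mod 2 = 1 -> Z.gcd p q = 1 ->
  good 0 p q (- p - q).
Proof.
intros Hp Op Oq G.
assert (G2 : Z.gcd q (2 * p) = 1).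
{ apply Zgcd_1_rel_prime, rel_prime_mult.
  - apply Zgcd_1_rel_prime; rewrite Z.gcd_comm.
    rewrite -Z.gcd_mod; [|lia]; rewrite Oq; reflexivity.
  - apply Zgcd_1_rel_prime; rewrite Z.gcd_comm; exact G. }
destruct (Z.gcd_bezout _ _ _ G2) as [u [v Hu]].
(* As u is odd, u p = p modulo 2p, hence u (- p - q) = - p - 1 = p - 1. *)
assert (Ou : exists w, u = 2 * w + 1).
{ exists (u / 2); Z.to_euclidean_division_equations; nia. }
destruct Ou as [w Hw].
assert (per : forall x y e, x = y + 2 * p * e -> twisted_word p x = twisted_word p y).
{ intros x y e E; unfold twisted_word.
  replace (x mod (2 * p)) with (y mod (2 * p)); [reflexivity|].
  rewrite E (Z.mul_comm (2 * p)) Z.mod_add; [reflexivity|lia]. }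
exists (fun x => twisted_word p (u * x)); intros n i Hi.
rewrite (per (u * (n + 0)) (u * n) 0); [|ring].
rewrite (per (u * (n + p)) (u * n + p) w); [|rewrite Hw; ring].
rewrite (per (u * (n + q)) (u * n + 1) (- v)); [|lia].
rewrite (per (u * (n + (- p - q))) (u * n + (p - 1)) (v - w - 1)); [|nia].
exact (twisted_word_good Hp Op (u * n) Hi).
Qed.

(** By coprimality exactly two of p, q, - p - q are odd. They are distinct, and not opposite as the
    third is nonzero, so they are not both 1 or -1 and one has absolute value at least 3. *)
Lemma good_zero_sum p q : Z.gcd p q = 1 -> p <> 0 -> q <> 0 -> p + q <> 0 -> p <> q ->
  2 * p + q <> 0 -> p + 2 * q <> 0 -> good 0 p q (- p - q).
Proof.
intros G Np Nq Ns Nd N1 N2.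
assert (pos : forall a b, Z.gcd a b = 1 -> a mod 2 = 1 -> b mod 2 = 1 ->
   3 <= Z.abs a -> good 0 a b (- a - b)).
{ intros a b Gab Oa Ob Ha; destruct (Z_le_gt_dec 3 a).
  - apply good_zero_sum_odd; assumption.
  - replace (good 0 a b (- a - b)) with (good (- 0) (- - a) (- - b) (- (- - a - - b)))
      by (f_equal; lia).
    apply good_opp, good_zero_sum_odd; try lia.
    + Z.to_euclidean_division_equations; lia.
    + Z.to_euclidean_division_equations; lia.
    + rewrite Z.gcd_opp_l Z.gcd_opp_r; exact Gab. }
assert (odd : forall a b, Z.gcd a b = 1 -> a mod 2 = 1 -> b mod 2 = 1 ->
   a <> b -> a + b <> 0 -> good 0 a b (- a - b)).
{ intros a b Gab Oa Ob Nab Sab; destruct (Z_le_gt_dec 3 (Z.abs a)).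
  - apply pos; assumption.
  - apply good_swap23; replace (- a - b) with (- b - a) by ring; apply pos; try assumption.
    + rewrite Z.gcd_comm; exact Gab.
    + Z.to_euclidean_division_equations; lia. }
pose proof (Z.mod_pos_bound p 2 ltac:(lia)); pose proof (Z.mod_pos_bound q 2 ltac:(lia)).
destruct (Z.eq_dec (p mod 2) 1) as [Op|Op]; destruct (Z.eq_dec (q mod 2) 1) as [Oq|Oq].
- apply odd; assumption.
- apply good_swap34.
  replace (good 0 p (- p - q) q) with (good 0 p (- p - q) (- p - (- p - q))) by (f_equal; ring).
  apply odd; try assumption; try lia.
  + replace (- p - q) with (- (q + 1 * p)) by ring.
    rewrite Z.gcd_opp_r Z.gcd_add_mult_diag_r; exact G.
  + Z.to_euclidean_division_equations; lia.
- apply good_swap23, good_swap34.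
  replace (good 0 q (- p - q) p) with (good 0 q (- p - q) (- q - (- p - q))) by (f_equal; ring).
  apply odd; try assumption; try lia.
  + replace (- p - q) with (- (p + 1 * q)) by ring.
    rewrite Z.gcd_opp_r Z.gcd_add_mult_diag_r Z.gcd_comm; exact G.
  + Z.to_euclidean_division_equations; lia.
- assert (D : (2 | Z.gcd p q)).
  { apply Z.gcd_greatest; apply Z.mod_divide; lia. }
  rewrite G in D; destruct D; lia.
Qed.

(** * Small modulus *)

Definition small_gaps (m p q r : Z) : bool :=
  (p <=? q) && (q <=? r) && (3 * p <=? m) && (3 * (q - p) <=? m) &&
  (3 * (r - q) <=? m) && (3 * (m - r) <=? m).

Definition circle_test (m k a b c : Z) : bool :=
  let p := (k * a) mod m in let q := (k * b) mod m in let r := (k * c) mod m in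
  small_gaps m p q r || small_gaps m p r q || small_gaps m q p r ||
  small_gaps m q r p || small_gaps m r p q || small_gaps m r q p.

Lemma good_circle_residues m k a b c : 0 < m ->
  small_gaps m ((k * a) mod m) ((k * b) mod m) ((k * c) mod m) = true -> good 0 a b c.
Proof.
intros Hm H; unfold small_gaps in H; rewrite !Bool.andb_true_iff !Z.leb_le in H.
pose proof (Z.mod_pos_bound (k * a) m Hm); pose proof (Z.mod_pos_bound (k * b) m Hm).
pose proof (Z.mod_pos_bound (k * c) m Hm).
pose proof (Z.div_mod (k * a) m ltac:(lia)); pose proof (Z.div_mod (k * b) m ltac:(lia)).
pose proof (Z.div_mod (k * c) m ltac:(lia)).
apply (@good_circle m k 0 a b c 0 (k * a / m) (k * b / m) (k * c / m)); lia.
Qed.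

Lemma good_circle_test m k a b c : 0 < m -> circle_test m k a b c = true -> good 0 a b c.
Proof.
intros Hm H; unfold circle_test in H; rewrite !Bool.orb_true_iff in H.
destruct H as [[[[[H|H]|H]|H]|H]|H]; apply (good_circle_residues Hm) in H.
- exact H.
- apply good_swap34; exact H.
- apply good_swap23; exact H.
- apply good_swap23, good_swap34; exact H.
- apply good_swap34, good_swap23; exact H.
- apply good_swap23, good_swap34, good_swap23; exact H.
Qed.

(** The two equations skipped say that b or a is the mean of {0, a, b, c}. The moduli tried run from
    3 to 34, and k stops at m/2 because - k only reverses the circle. *)
Definition small_case (lim a b c : Z) : bool :=
  if lim <? b + c - a then true else
  if (Z.gcd a (Z.gcd b c) =? 1) && negb (c =? 3 * b - a) && negb (3 * a =? b + c) then
    if anyb 32 (fun m => anyb (Z.to_nat (m / 2)) (fun k => circle_test m k a b c) 1) 3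
    then true
    else ((a =? 1) && (b =? 7) && (c =? 9)) || ((a =? 2) && (b =? 8) && (c =? 9))
  else true.

Definition small_check (lim : Z) : bool :=
  allb (Z.to_nat lim) (fun a => allb (Z.to_nat lim) (fun b => allb (Z.to_nat lim)
    (fun c => small_case lim a b c) (b + 1)) (a + 1)) 1.

Lemma small_checkP lim a b c : small_check lim = true -> 0 < a -> a < b -> b < c ->
  b + c - a <= lim -> small_case lim a b c = true.
Proof.
intros H Ha Hb Hc Hm.
pose proof (allbP H (j := a) ltac:(lia)) as H1; cbv beta in H1.
pose proof (allbP H1 (j := b) ltac:(lia)) as H2; cbv beta in H2.
exact (allbP H2 (j := c) ltac:(lia)).
Qed.

Lemma small_check_40 : small_check 40 = true.
Proof. vm_cast_no_check (erefl true). Qed.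

(* The two sets {0,1,7,9} and 9 - {0,1,7,9} have no circle coloring. *)
Definition word15 (x : Z) : Z :=
  List.nth (Z.to_nat (x mod 15)) [:: 0; 0; 0; 1; 0; 0; 1; 1; 1; 2; 2; 1; 2; 2; 2] 0.

Lemma good_0179 : good 0 1 7 9.
Proof.
exists word15; intros n i Hi.
assert (per : forall s, word15 (n + s) = word15 (n mod 15 + s)).
{ intro s; unfold word15; rewrite Z.add_mod_idemp_l; [reflexivity|lia]. }
rewrite !per.
assert (C : allb 15 (fun r => allb 3 (fun j =>
   (word15 (r + 0) =? j) || ((word15 (r + 1) =? j) ||
   ((word15 (r + 7) =? j) || (word15 (r + 9) =? j)))) 0) 0 = true) by (vm_compute; reflexivity).
pose proof (Z.mod_pos_bound n 15 ltac:(lia)).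
pose proof (allbP C (j := n mod 15) ltac:(lia)) as C1; cbv beta in C1.
pose proof (allbP C1 (j := i) ltac:(lia)) as C2; cbv beta in C2.
rewrite !Bool.orb_true_iff !Z.eqb_eq in C2; exact C2.
Qed.

Lemma good_small a b c : 0 < a -> a < b -> b < c -> Z.gcd a (Z.gcd b c) = 1 ->
  c <> 3 * b - a -> 3 * a <> b + c -> b + c - a <= 40 -> good 0 a b c.
Proof.
intros Ha Hb Hc G N1 N2 Hm.
pose proof (small_checkP small_check_40 Ha Hb Hc Hm) as H; unfold small_case in H.
destruct (Z.ltb_spec 40 (b + c - a)); [lia|].
rewrite G Z.eqb_refl in H; cbn [andb] in H.
destruct (Z.eqb_spec c (3 * b - a)); [lia|].
destruct (Z.eqb_spec (3 * a) (b + c)); [lia|].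
cbn [negb andb] in H.
match type of H with (if ?t then _ else _) = _ => destruct t eqn:E end.
- apply anybP in E; destruct E as [m [Hm' E]]; cbv beta in E.
  apply anybP in E; destruct E as [k [_ E]]; cbv beta in E.
  apply (@good_circle_test m k); [lia|exact E].
- rewrite Bool.orb_true_iff !Bool.andb_true_iff !Z.eqb_eq in H.
  destruct H as [[[-> ->] ->]|[[-> ->] ->]]; [exact good_0179|].
  pose proof (good_translate 9 (good_opp good_0179)) as T; cbn in T.
  apply good_swap12, good_swap23, good_swap34, good_swap12, good_swap23, good_swap12; exact T.
Qed.

(** * * Arbitrary sets of four integers *)

Lemma gcd3_eq1 x y z : (forall d, 0 <= d -> (d | x) -> (d | y) -> (d | z) -> d = 1) ->
  Z.gcd x (Z.gcd y z) = 1.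
Proof.
intro H; apply H; [apply Z.gcd_nonneg|apply Z.gcd_divide_l| |];
  (eapply Z.divide_trans; [apply Z.gcd_divide_r|]); [apply Z.gcd_divide_l|apply Z.gcd_divide_r].
Qed.

Lemma good_coprime a b c : 0 < a -> a < b -> b < c -> Z.gcd a (Z.gcd b c) = 1 -> good 0 a b c.
Proof.
intros Ha Hb Hc G.
assert (G1 : forall d, 0 <= d -> (d | a) -> (d | b) -> (d | c) -> d = 1).
{ intros d Hd Da Db Dc; apply Z.divide_1_r_nonneg; [exact Hd|].
  rewrite -G; apply Z.gcd_greatest; [exact Da|apply Z.gcd_greatest; assumption]. }
(* Moving the mean of S, here b and in the next case a, to 0 gives a set {0, p, q, - p - q}. *)
destruct (Z.eq_dec c (3 * b - a)) as [E|N1].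
{ assert (T : good 0 (- b) (a - b) (- - b - (a - b))).
  { apply good_zero_sum; try lia.
    apply G1; [apply Z.gcd_nonneg| | |].
    - replace a with ((a - b) - (- b)) at 2 by ring.
      apply Z.divide_sub_r; [apply Z.gcd_divide_r|apply Z.gcd_divide_l].
    - apply Z.divide_opp_r, Z.gcd_divide_l.
    - rewrite E; replace (3 * b - a) with ((-2) * (- b) - (a - b)) by ring.
      apply Z.divide_sub_r; [apply Z.divide_mul_r, Z.gcd_divide_l|apply Z.gcd_divide_r]. }
  apply (good_translate b) in T.
  replace (0 + b) with b in T by ring; replace (- b + b) with 0 in T by ring.
  replace (a - b + b) with a in T by ring.
  replace (- - b - (a - b) + b) with c in T by lia.
  apply good_swap23, good_swap12; exact T. }
destruct (Z.eq_dec (3 * a) (b + c)) as [E|N2].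
{ assert (T : good 0 (b - a) (c - a) (- (b - a) - (c - a))).
  { apply good_zero_sum; try lia.
    assert (Da : (Z.gcd (b - a) (c - a) | a)).
    { replace a with ((b - a) + (c - a)) at 3 by lia.
      apply Z.divide_add_r; [apply Z.gcd_divide_l|apply Z.gcd_divide_r]. }
    apply G1; [apply Z.gcd_nonneg|exact Da| |].
    - replace b with ((b - a) + a) at 2 by ring.
      apply Z.divide_add_r; [apply Z.gcd_divide_l|exact Da].
    - replace c with ((c - a) + a) at 2 by ring.
      apply Z.divide_add_r; [apply Z.gcd_divide_r|exact Da]. }
  apply (good_translate a) in T.
  replace (0 + a) with a in T by ring; replace (b - a + a) with b in T by ring.
  replace (c - a + a) with c in T by ring.
  replace (- (b - a) - (c - a) + a) with 0 in T by lia.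
  apply good_swap12, good_swap23, good_swap34; exact T. }
destruct (Z_le_gt_dec (b + c - a) 40); [apply good_small; assumption|].
assert (H : hit (b + c - a) b c).
{ assert (Gm : Z.gcd b (Z.gcd c (b + c - a)) = 1).
  { apply gcd3_eq1; intros d Hd Db Dc Dm; apply G1; try assumption.
    replace a with (b + c - (b + c - a)) by ring.
    apply Z.divide_sub_r; [apply Z.divide_add_r; assumption|assumption]. }
  assert (D1 : ~ (b + c - a | b)) by (intro D; apply Z.divide_pos_le in D; lia).
  assert (D2 : ~ (b + c - a | c)) by (intro D; apply Z.divide_pos_le in D; lia).
  (* With m = b + c - a, 0 < 2 (c - b) < 2m leaves only the value m, that is c = 3b - a; below, 2m <
     2 (b + c) < 4m leaves only 3m, that is 3a = b + c. *)
  assert (D3 : ~ (b + c - a | 2 * (b - c))).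
  { intros [e He]; assert (e = 0 \/ e = -1 \/ e <= -2 \/ 1 <= e) as [?|[?|[?|?]]] by lia;
      [subst e; lia|subst e; lia|nia|nia]. }
  assert (D4 : ~ (b + c - a | 2 * (b + c))).
  { intros [e He]; assert (e <= 2 \/ e = 3 \/ 4 <= e) as [?|[?|?]] by lia;
      [nia|subst e; lia|nia]. }
  destruct (Z_le_gt_dec (b + c - a) 225).
  - apply hit_medium; auto; lia.
  - apply hit_large; auto; lia. }
apply good_hit in H; [|lia].
replace (b + c - (b + c - a)) with a in H by ring.
apply good_swap23, good_swap34; exact H.
Qed.

Lemma good_increasing a b c d : a < b -> b < c -> c < d -> good a b c d.
Proof.
intros Hb Hc Hd.
set (g := Z.gcd (b - a) (Z.gcd (c - a) (d - a))).
destruct (Z.gcd_divide_l (b - a) (Z.gcd (c - a) (d - a))) as [b' Eb].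
destruct (Z.gcd_divide_r (b - a) (Z.gcd (c - a) (d - a))) as [h Eh].
destruct (Z.gcd_divide_l (c - a) (d - a)) as [c0 Ec].
destruct (Z.gcd_divide_r (c - a) (d - a)) as [d0 Ed].
pose proof (Z.gcd_nonneg (b - a) (Z.gcd (c - a) (d - a))) as Hg.
fold g in Eb, Eh, Hg.
assert (Hg0 : 0 < g) by (destruct (Z.eq_dec g 0) as [E|]; [rewrite E in Eb; lia|lia]).
rewrite Eh Z.mul_assoc in Ec; rewrite Eh Z.mul_assoc in Ed.
set (c' := c0 * h) in Ec; set (d' := d0 * h) in Ed.
assert (G : Z.gcd b' (Z.gcd c' d') = 1).
{ assert (E : g * Z.gcd b' (Z.gcd c' d') = g * 1).
  { rewrite -!Z.gcd_mul_mono_l_nonneg; try lia.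
    rewrite !(Z.mul_comm g) -Eb -Ec -Ed Z.mul_1_l; reflexivity. }
  apply Z.mul_reg_l in E; [exact E|lia]. }
clearbody c' d' g.
pose proof (good_translate a (good_scale Hg0 (@good_coprime b' c' d' ltac:(nia) ltac:(nia) ltac:(nia) G))) as T.
replace (g * 0 + a) with a in T by ring.
replace (g * b' + a) with b in T by lia; replace (g * c' + a) with c in T by lia.
replace (g * d' + a) with d in T by lia.
exact T.
Qed.

End IntegerSets.

(** * * Transfer to colorings of [int] *)

Lemma good_polychromatic (a b c d : int) :
  good (Z_of_int a) (Z_of_int b) (Z_of_int c) (Z_of_int d) ->
  exists f : int -> 'I_3, polychromatic [:: a; b; c; d] f.
Proof.
case=> f Hf; exists (fun x => inord (Z.to_nat (f (Z_of_int x)))) => n i.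
have Hi : (0 <= Z.of_nat i < 3)%Z by have := ltn_ord i; lia.
have E x : f (Z_of_int n + Z_of_int x)%Z = Z.of_nat i ->
    inord (Z.to_nat (f (Z_of_int (n + x)%R))) = i :> 'I_3.
  have -> : Z_of_int (n + x)%R = (Z_of_int n + Z_of_int x)%Z by lia.
  by move=> ->; rewrite Nat2Z.id inord_val.
case: (Hf (Z_of_int n) _ Hi) => [|[|[|]]] /E Ei.
- by exists (n + a)%R; rewrite // /translate !inE eqxx.
- by exists (n + b)%R; rewrite // /translate !inE eqxx ?orbT.
- by exists (n + c)%R; rewrite // /translate !inE eqxx ?orbT.
- by exists (n + d)%R; rewrite // /translate !inE eqxx ?orbT.
Qed.

Lemma polychromatic_perm (S T : seq int) (k : nat) (f : int -> 'I_k) :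
  perm_eq S T -> polychromatic S f -> polychromatic T f.
Proof.
move=> eqST polyS n i; have [x Sx fx] := polyS n i.
by exists x; rewrite // -(perm_mem (perm_map (fun s => n + s)%R eqST)).
Qed.

(* p_Z(S) >= 3 for every 4-element S ⊆ Z: there is an S-polychromatic
   3-coloring of Z. *)
Theorem theorem1 (S : seq int) (hS : uniq S) (hsz : size S = 4%N) :
  exists c : int -> 'I_3, polychromatic S c.
Proof.
have sortS : sorted <%O (sort <=%O S) by rewrite Order.TotalTheory.sort_lt_sorted.
have permS : perm_eq (sort <=%O S) S by rewrite perm_sort.
have := perm_size permS; rewrite hsz.
case: (sort _ _) sortS permS => [|a [|b [|c [|d [|? ?]]]]] //= /and4P[ab bc cd _] permS _.
have [f polyf] : exists f : int -> 'I_3, polychromatic [:: a; b; c; d] f.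
  by apply: good_polychromatic; apply: good_increasing; lia.
by exists f; apply: polychromatic_perm permS polyf.
Qed.
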